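(* Let $\mathcal{L}^{(M)}$ be an exactly solvable operator that factorizes on $\mathbb{P}$, with factors $\rho_{m_1},\dots,\rho_{m_J}$ having only real zeros, and assume that the condition ''$\sum_{i=1}^{j}(m_i-n_i)\ge0$ for all $j\le J$'' is not satisfied. Let $\mu\in\Xi_{\mathcal{L}^{(M)}}\neq\emptyset$ with $\mathrm{supp}(\mu)\subset[-1,1]$. Let $j_0$ be the largest index such that $\sum_{i=1}^{j_0}(m_i-n_i)<0$, and $n'_{j_0}=\sum_{i=1}^{j_0}(n_i-m_i)-1$. Consider a sequence (indexed by $n>n'_{j_0}$) of multisets of real numbers $\{\nu_{1,n},\dots,\nu_{n'_{j_0}+1,n}\}$ such that $\{1,x,\dots,x^{n'_{j_0}}\}$ is an interpolating system for each of them. Then the zeros of all polynomials of the sequence $\{Q_n\}_{n>n'_{j_0}}$ of monic orthogonal polynomials with respect to $(\mathcal{L}^{(M)},\mu)$ (with $\deg Q_n=n$) such that $Q_n(\nu_{j,n})=0$, $1\le j\le n'_{j_0}+1$ (counting multiplicity), are located in a (closed) disk of radius $R=3^Md$, where $d=\max\{1,\sup_{z\in C_M^*}|z|\}$, $C_M^*=\bigcup_{n}C^*_{M,n}$, and $C^*_{M,n}$ is the convex hull of the zeros of $(x-\nu_{1,n})\cdots(x-\nu_{n'_{j_0}+1,n})\prod_{i=1}^{J}\rho_{m_i}(x)$.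
   Context: $\mathbb{P}$ is the space of polynomials. An exactly solvable operator of order $M$ is $\mathcal{L}^{(M)}=\sum_{k=0}^{M}\rho_k(z)\frac{d^k}{dz^k}$ with polynomials $\rho_k(z)=\sum_{j=0}^k\rho_{k,j}z^j$, $\deg\rho_k=k$ for at least one $k$, $\rho_M\not\equiv0$. For $M\ge1$, $\mathcal{L}^{(M)}$ factorizes on $\mathbb{P}$ if there exist multi-indices $(m_1,\dots,m_J)$, $(n_1,\dots,n_J)$ and polynomials $\rho_{m_j}$ with $\deg\rho_{m_j}=m_j$ such that for every polynomial $\Pi$ $$\mathcal{L}^{(M)}[\Pi]=\left[\rho_{m_J}\cdots\left[\rho_{m_2}\left[\rho_{m_1}\Pi\right]^{(n_1)}\right]^{(n_2)}\cdots\right]^{(n_J)}.$$ Exact solvability forces $\sum m_k=\sum n_k=M$. $Q_n$ is orthogonal with respect to $(\mathcal{L}^{(M)},\mu)$ (for the index $n$) if $\deg Q_n\le n$ and $\int\mathcal{L}^{(M)}[Q_n](x)P(x)\,d\mu(x)=0$ for every polynomial $P$ with $\deg P\le n-1$. Let $\lambda_n=\sum_{k=0}^{M}\rho_{k,k}\frac{n!}{(n-k)!}$ (with $\frac{n!}{(n-k)!}=0$ for $k>n$) and $S=\{n\ge0:\lambda_n=0\}$. $\Xi_{\mathcal{L}^{(M)}}$ is the class of finite positive Borel measures supported in $\mathbb{R}$ (finite moments $\mu_i=\int x^id\mu$, infinite support) whose moments satisfy, for all $\sigma\in S$ and all $n\notin S$, $$\sum_{v=-M}^{\sigma}\left(\sum_{k=\max(-v,0)}^{M}\sum_{i=\max(0,v)}^{\min(\sigma,v+k)}(-1)^{i+\sigma}\frac{n!}{(n-k)!}\Delta_{\sigma,i}\rho_{k,v-i+k}\right)\mu_{n+v}=0,$$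 where $\Delta_{0,0}=\mu_0$ and, for $\sigma\geq 1$, $\Delta_{\sigma,i}$ is the determinant of $(\mu_{r+c})_{0\le r\le\sigma-1,0\le c\le\sigma}$ with the column $c=i$ deleted. A set of $N$ polynomials $\{\pi_1,\dots,\pi_N\}$ is an interpolating system for a multiset of $N$ points if the $N\times N$ determinant whose rows are $(\pi_1^{(l)}(\nu),\dots,\pi_N^{(l)}(\nu))$, with $\nu$ running over the distinct points and $0\le l\le(\text{multiplicity of }\nu)-1$, is nonzero.
   Formalization: It is assumed that for each n > n'_{j_0} Q_n is the only monic orthogonal polynomial of degree n vanishing at the nodes; if the kernel of the operator has dimension above n'_{j_0}+1, Q_n is not determined and the bound fails. *)

(* Defs.v *)
(* MathComp world, with MathComp-Analysis and the complex numbers R[i] of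
   mathcomp-real-closed. *)
From HB Require Import structures.
From mathcomp Require Export all_boot all_order all_algebra.
From mathcomp Require Export all_classical all_reals all_analysis.
From mathcomp Require Export complex.

Set Implicit Arguments.
Unset Strict Implicit.
Unset Printing Implicit Defensive.

Export Order.TTheory GRing.Theory Num.Theory.
Export numFieldNormedType.Exports.

Local Open Scope classical_set_scope.
Local Open Scope ring_scope.
Local Open Scope complex_scope.

(* All polynomials have complex coefficients; the degree of p is (size p).-1,
   so that "deg p <= n" is size p <= n.+1 and "deg p = n" is size p = n.+1. *)

Section Operators.
Context {R : realType}.

Definition diff_op (M : nat) (rho : nat -> {poly R[i]}) (p : {poly R[i]}) :
    {poly R[i]} :=
  \sum_(k < M.+1) rho k * p^`(k).

Definition exactly_solvable (M : nat) (rho : nat -> {poly R[i]}) : Prop :=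
  [/\ forall k : nat, (k <= M)%N -> (size (rho k) <= k.+1)%N,
      exists2 k : nat, (k <= M)%N & size (rho k) = k.+1
    & rho M != 0].

(* enum 'I_J lists the indices in increasing order, so that r 0 is the
   innermost factor. Indices start at 0 instead of 1. *)
Definition iterated_op (J : nat) (nn : 'I_J -> nat) (r : 'I_J -> {poly R[i]})
    (p : {poly R[i]}) : {poly R[i]} :=
  foldl (fun q j => (r j * q)^`(nn j)) p (enum 'I_J).

Definition is_factorization (M : nat) (rho : nat -> {poly R[i]})
    (J : nat) (m nn : 'I_J -> nat) (r : 'I_J -> {poly R[i]}) : Prop :=
  [/\ (1 <= M)%N,
      forall j, size (r j) = (m j).+1
    & forall p, diff_op M rho p = iterated_op nn r p].

Definition eigenval (M : nat) (rho : nat -> {poly R[i]}) (n : nat) : R[i] :=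
  \sum_(k < M.+1) (rho k)`_k * (n ^_ k)%:R.

Definition null_index (M : nat) (rho : nat -> {poly R[i]}) (n : nat) : Prop :=
  eigenval M rho n = 0.

End Operators.

(* \sum_(i <= j) (m_i - n_i), in int *)
Definition partial_diff (J : nat) (m nn : 'I_J -> nat) (j : 'I_J) : int :=
  \sum_(i < J | (i <= j)%N) ((m i)%:Z - (nn i)%:Z).

Section Measures.
Context {R : realType}.
Implicit Type mu : {finite_measure set (measurableTypeR R) -> \bar R}.

Definition msupport mu : set R :=
  [set x | forall U : set R, open U -> U x -> (0 < mu U)%E].

Definition moment mu (k : nat) : R := Rintegral mu setT (fun x : R => x ^+ k).

Definition has_moments mu : Prop :=
  forall k : nat, mu.-integrable setT (fun x : R => (x ^+ k)%:E).

Definition Cintegral mu (f : R -> R[i]) : R[i] :=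
  Rintegral mu setT (fun x => complex.Re (f x))
    +i* Rintegral mu setT (fun x => complex.Im (f x)).

Definition Delta mu (s : nat) (i : 'I_s.+1) : R :=
  if s == 0%N then moment mu 0
  else \det (col' i (\matrix_(a < s, c < s.+1) moment mu (a + c))).

(* The index v runs over -M, ..., s and is encoded as w - M with w < M + s + 1.
   The index v - i + k of the coefficient of rho_k is nonnegative on the range
   of summation. The index n + v of the moment may be negative, but then
   n < - v <= k throughout the inner sum, so that n ^_ k = 0 and the moment
   selected by absz is multiplied by 0. *)
Definition Xi_sum (M : nat) (rho : nat -> {poly R[i]}) mu (s n : nat) : R[i] :=
  \sum_(w < (M + s).+1)
    let v : int := w%:Z - M%:Z in
    (\sum_(k < M.+1 | - v <= k%:Z)
      \sum_(i < s.+1 | (v <= i%:Z) && (i%:Z <= v + k%:Z))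
        (-1) ^+ (i + s) * (n ^_ k)%:R * (Delta mu i)%:C
          * (rho k)`_(absz (v - i%:Z + k%:Z)))
    * (moment mu (absz (n%:Z + v)))%:C.

Definition in_Xi (M : nat) (rho : nat -> {poly R[i]}) mu : Prop :=
  [/\ has_moments mu, infinite_set (msupport mu)
    & forall s n : nat, null_index M rho s -> ~ null_index M rho n ->
        Xi_sum M rho mu s n = 0].

Definition orthogonal_wrt (M : nat) (rho : nat -> {poly R[i]}) mu
    (n : nat) (Q : {poly R[i]}) : Prop :=
  (size Q <= n.+1)%N /\
  forall P : {poly R[i]}, (size P <= n)%N ->
    Cintegral mu (fun x => (diff_op M rho Q).[x%:C] * P.[x%:C]) = 0.

(* product of the X - t over the multiset nu of real points *)
Definition node_poly (N : nat) (nu : N.-tuple R) : {poly R[i]} :=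
  \prod_(t <- nu) ('X - (t%:C)%:P).

(* Q vanishes at the points of nu, counting multiplicity, iff it is divisible
   by node_poly nu. *)
Definition monic_orthogonal_vanishing (M : nat) (rho : nat -> {poly R[i]}) mu
    (n N : nat) (nu : N.-tuple R) (Q : {poly R[i]}) : Prop :=
  [/\ Q \is monic, size Q = n.+1, orthogonal_wrt M rho mu n Q
    & node_poly nu %| Q].

End Measures.

(* The multiset of points is an N-tuple t. Its j-th entry gives the row of the
   derivatives of order l at t_j, where l counts the occurrences of t_j before
   position j; the pairs (t_j, l) are exactly the pairs (point, order) with
   order < multiplicity, each occurring once. *)
Definition interpolating_system (F : fieldType) (N : nat)
    (p : 'I_N -> {poly F}) (t : N.-tuple F) : Prop :=
  \det (\matrix_(j < N, k < N)
    ((p k)^`(count_mem (tnth t j) (take j t))).[tnth t j]) != 0.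

Section Geometry.
Context {R : realType}.

Definition zero_set (p : {poly R[i]}) : set R[i] := [set z | root p z].

Definition cplx_convex_hull (A : set R[i]) : set R[i] :=
  [set z | exists (k : nat) (a : 'I_k -> R) (x : 'I_k -> R[i]),
    [/\ forall i, 0 <= a i, \sum_(i < k) a i = 1, forall i, A (x i)
      & z = \sum_(i < k) (a i)%:C * x i]].

(* modulus, as an element of R *)
Definition cmod (z : R[i]) : R := ComplexField.Normc.normc z.

Definition hull_radius (A : set R[i]) : \bar R :=
  maxe 1%E (ereal_sup [set (cmod z)%:E | z in A]).

End Geometry.

(* Main.v *)
Require Import Defs.
From mathcomp Require Import ring lra zify.
From mathcomp Require polyrcf polyorder measurable_realfun.

(** Let [f] be the polynomial [Q n] and [g] its image under the operator. The
    orthogonality relations say that [g] is orthogonal to all polynomials of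
    smaller degree, so its zeros lie in [[-1, 1]]
    ([orthogonal_roots_in_disk]). One then goes back from [g] to [f] through the
    factorization: each step divides by a factor, which can only remove zeros,
    or takes a primitive.

    A primitive is controlled as soon as one of its zeros is known. If all zeros
    of [p^`()] and one zero [x] of [p] lie in the disk of radius [B] around 0,
    then for every other zero [z] of [p] there is a critical point [w] with
    [|z - w| <= |x - w|], so that [|z| <= 3 B] ([root_deriv_bisector],
    [roots_in_disk_primitive]). This consequence of Grace's theorem is derived
    from Laguerre's theorem on polar derivatives. The number of primitives to
    take is at most [M], which is seen by comparing orders of vanishing
    ([order_fold_op_leq]), and the factors [3] multiply to [3 ^+ M].

    The known zeros come from the nodes and from the zeros of the factors. All
    of them are real, and [f] is real because its conjugate satisfies the same
    conditions ([monic_orthogonal_vanishing_conj]), so Rolle's theorem applies: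
    in a real polynomial, a differentiation loses only one of the zeros known to
    be in a given interval ([rolle_multiplicity]). It remains to see that one is
    left whenever a primitive is taken, that is, that for every initial segment
    of the factorization the number of differentiations is at most the number
    of nodes plus the degrees of the factors ([roots_in_disk_iterated]). This
    follows from uniqueness: if it failed, the operator would kill the node
    polynomial ([fold_op_kills]), and adding the latter to an orthogonal
    polynomial of larger degree would give another one. *)

Set Implicit Arguments.
Unset Strict Implicit.
Unset Printing Implicit Defensive.

Local Open Scope classical_set_scope.
Local Open Scope ring_scope.
Local Open Scope complex_scope.

(** * Polar derivatives and Laguerre's theorem for a half-plane *)

Section PolarDerivative.
Context {R : rcfType}.
Local Notation C := R[i].
Implicit Types (u s w z : C) (c : R).

Lemma ReB z w : complex.Re (z - w) = complex.Re z - complex.Re w.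
Proof. by case: z w => ? ? [? ?]. Qed.

Lemma ReD z w : complex.Re (z + w) = complex.Re z + complex.Re w.
Proof. by case: z w => ? ? [? ?]. Qed.

Lemma Re_sum (I : Type) (l : seq I) (F : I -> C) :
  complex.Re (\sum_(i <- l) F i) = \sum_(i <- l) complex.Re (F i).
Proof. by elim/big_rec2: _ => // i x y _ <-; rewrite ReD. Qed.

Lemma ImD z w : complex.Im (z + w) = complex.Im z + complex.Im w.
Proof. by case: z w => ? ? [? ?]. Qed.

Lemma Im_sum (I : Type) (l : seq I) (F : I -> C) :
  complex.Im (\sum_(i <- l) F i) = \sum_(i <- l) complex.Im (F i).
Proof. by elim/big_rec2: _ => // i x y _ <-; rewrite ImD. Qed.

Lemma Re_natl n z : complex.Re (n%:R * z) = n%:R * complex.Re z.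
Proof.
rewrite !mulr_natl; elim: n => [|n IHn]; first by rewrite !mulr0n.
by rewrite !mulrS ReD IHn.
Qed.

Lemma Im_natl n z : complex.Im (n%:R * z) = n%:R * complex.Im z.
Proof.
rewrite !mulr_natl; elim: n => [|n IHn]; first by rewrite !mulr0n.
by rewrite !mulrS ImD IHn.
Qed.

Lemma log_deriv_prod_XsubC (F : fieldType) (l : seq F) (s : F) :
  (\prod_(a <- l) ('X - a%:P)).[s] != 0 ->
  (\prod_(a <- l) ('X - a%:P))^`().[s] =
  (\prod_(a <- l) ('X - a%:P)).[s] * \sum_(a <- l) (s - a)^-1.
Proof.
elim: l => [|a l IHl]; first by rewrite !big_nil derivC horner0 mulr0.
rewrite !big_cons derivM !hornerE derivXsubC hornerC mul1r.
rewrite mulf_eq0 negb_or => /andP[sa /[dup] /IHl -> _].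
by rewrite mulrDr mulrAC mulfV // mul1r -mulrA.
Qed.

(** Inversion maps the half-plane [Re >= c] onto the disk [Re v >= c * |v|^2],
    and a disk is convex, so it contains the mean of the inverses. The
    convexity is used in the form of a supporting line: [c * |v|^2] is bounded
    below by its tangent at the mean. *)
Lemma harmonic_mean_halfplane (l : seq C) (y : C) c :
  0 < c -> (0 < size l)%N -> (forall x, x \in l -> c <= complex.Re x) ->
  \sum_(x <- l) x^-1 = (size l)%:R * y^-1 -> c <= complex.Re y.
Proof.
move=> c0 l0 lc.
set n := (size l)%:R : R; have n0 : 0 < n by rewrite ltr0n.
case: y => y1 y2 sumE.
pose v := (y1 +i* y2)^-1.
(* [lam >= 0] is the tangent half-plane at [v] of the disk [Re z >= c|z|^2]. *)
pose lam z := complex.Re z - 2 * c * (complex.Re v * complex.Re z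
   + complex.Im v * complex.Im z) + c * (complex.Re v ^+ 2 + complex.Im v ^+ 2).
have lam0 x : x \in l -> 0 <= lam x^-1 /\ 0 < complex.Re x^-1.
  move/lc; case: x => a b /= ca; rewrite /lam.
  case: (v) => p q /=.
  have N0 : 0 < a ^+ 2 + b ^+ 2.
    have: 0 < a ^+ 2 by rewrite exprn_gt0 // (lt_le_trans c0).
    by have := sqr_ge0 b; lra.
  set N := a ^+ 2 + b ^+ 2 in N0 *.
  have a0 : 0 < a by apply: lt_le_trans ca.
  split; last by rewrite divr_gt0.
  have NE : a / N = a * ((a / N) ^+ 2 + (- (b / N)) ^+ 2).
    by rewrite /N; field; rewrite -/N gt_eqF.
  rewrite {1}NE; set A := a / N; set B := - (b / N).
  have S0 : 0 <= A ^+ 2 + B ^+ 2 by rewrite addr_ge0 ?sqr_ge0.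
  have : c * (A ^+ 2 + B ^+ 2) <= a * (A ^+ 2 + B ^+ 2) by rewrite ler_wpM2r.
  have : 0 <= c * ((A - p) ^+ 2 + (B - q) ^+ 2).
    by rewrite mulr_ge0 ?addr_ge0 ?sqr_ge0 // ltW.
  by nra.
have Rev0 : 0 < n * complex.Re v.
  rewrite -Re_natl -sumE Re_sum.
  case: (l) l0 lam0 => // x l' _ lam0; rewrite big_cons.
  apply: ltr_wpDr; last by apply: (lam0 x _).2; rewrite mem_head.
  rewrite big_seq; apply: sumr_ge0 => i il; apply/ltW/(lam0 i _).2.
  by rewrite inE il orbT.
have sumlam : \sum_(x <- l) lam x^-1 = n * lam v.
  have -> : n * lam v = n * complex.Re v
     - 2 * c * (complex.Re v * (n * complex.Re v)
               + complex.Im v * (n * complex.Im v))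
     + n * (c * (complex.Re v ^+ 2 + complex.Im v ^+ 2)).
    by rewrite /lam; ring.
  rewrite -Re_natl -Im_natl -sumE /n.
  elim: (l) => [|x l' IH]; first by rewrite !big_nil /=; ring.
  rewrite !big_cons IH ReD ImD.
  by rewrite [size (x :: l')]/= -[(size l').+1%:R]natr1 /lam; ring.
have : 0 <= lam v.
  rewrite -(pmulr_rge0 _ n0) -sumlam big_seq; apply: sumr_ge0 => x xl.
  exact: (lam0 x xl).1.
move: Rev0; rewrite pmulr_rgt0 // /lam {lam lam0 sumlam sumE} /v /= => Rev0.
set N := y1 ^+ 2 + y2 ^+ 2 in Rev0 *.
have N0 : 0 < N.
  rewrite lt_neqAle addr_ge0 ?sqr_ge0 // andbT eq_sym; apply/eqP => N0.
  by move: Rev0; rewrite N0 invr0 mulr0 ltxx.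
have -> : (y1 / N - 2 * c * (y1 / N * (y1 / N) + - (y2 / N) * - (y2 / N)) +
  c * ((y1 / N) ^+ 2 + (- (y2 / N)) ^+ 2)) = (y1 - c) / N.
  by rewrite /N; field; rewrite -/N gt_eqF.
by rewrite pmulr_lge0 ?invr_gt0 // subr_ge0.
Qed.

(** Here [w] is the pole, and [n] the degree in which [g] is considered, which
    may exceed its actual degree. *)
Definition polar_deriv (n : nat) (w : C) (g : {poly C}) : {poly C} :=
  n%:R *: g + (w%:P - 'X) * g^`().

Lemma polar_derivZ n w k g : polar_deriv n w (k *: g) = k *: polar_deriv n w g.
Proof.
by rewrite /polar_deriv derivZ scalerDr -scalerAr !scalerA mulrC.
Qed.

(** Laguerre's theorem. At a zero [s] of the polar derivative, [w - s] is the
    harmonic mean of the [a - s], where [a] runs over the zeros of the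
    polynomial. If [s] were outside the half-plane that contains these zeros,
    the harmonic mean would force the pole [w] into that half-plane. *)
Lemma laguerre_root u c (l : seq C) w s :
  (0 < size l)%N -> (forall a, a \in l -> c <= complex.Re (u * a)) ->
  complex.Re (u * w) < c ->
  root (polar_deriv (size l) w (\prod_(a <- l) ('X - a%:P))) s ->
  c <= complex.Re (u * s).
Proof.
move=> l0 lc wc; rewrite leNgt => /rootP gs; apply/negP => sc.
move: gs; rewrite /polar_deriv !hornerE.
have lN0 : (size l)%:R != 0 :> C by rewrite pnatr_eq0 -lt0n.
have sl : (\prod_(a <- l) ('X - a%:P)).[s] != 0.
  rewrite -rootE root_prod_XsubC; apply/negP => /lc.
  by rewrite leNgt sc.
rewrite log_deriv_prod_XsubC // mulrCA mulrC -mulrDr.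
move=> /eqP; rewrite mulf_eq0 (negPf sl) /= => /eqP sumE.
have ws : w - s != 0.
  by apply: contraNneq lN0 => ws; move: sumE; rewrite ws mul0r addr0 => ->.
have u0 : u != 0.
  case: (l) lc l0 => // a l' /(_ a (mem_head _ _)) ca _.
  by apply: contraTneq (lt_le_trans wc ca) => ->; rewrite !mul0r ltxx.
have : c - complex.Re (u * s) <= complex.Re (u * (w - s)).
  apply: (@harmonic_mean_halfplane [seq u * (a - s) | a <- l]).
  - by rewrite subr_gt0.
  - by rewrite size_map.
  - by move=> _ /mapP[a /lc ca ->]; rewrite mulrBr ReB lerD2r.
  rewrite size_map big_map invfM.
  under eq_bigr do rewrite invfM -opprB invrN mulrN.
  rewrite sumrN -mulr_sumr.
  apply: (mulfI ws); apply: (mulfI u0).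
  have -> : u * ((w - s) * - (u^-1 * \sum_(i <- l) (s - i)^-1))
      = - ((w - s) * \sum_(i <- l) (s - i)^-1) by field.
  move/eqP: sumE; rewrite addr_eq0 => /eqP <-.
  by field; rewrite ?u0 ?ws.
by rewrite mulrBr ReB lerD2r leNgt wc.
Qed.

(** The leading terms cancel. The next coefficient of the polar derivative is
    the sum of the [w - a], which does not vanish because the pole is
    separated by a line from all zeros [a]. *)
Lemma laguerre_size u c (l : seq C) w :
  (0 < size l)%N -> (forall a, a \in l -> c <= complex.Re (u * a)) ->
  complex.Re (u * w) < c ->
  size (polar_deriv (size l) w (\prod_(a <- l) ('X - a%:P))) = size l.
Proof.
move=> l0 lc wc.
have sg := size_prod_XsubC l id; rewrite /= in sg.
set g := \prod_(a <- l) _ in sg *.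
have g1 : g`_(size l) = 1.
  by have /monicP := monic_prod_XsubC l xpredT id; rewrite lead_coefE sg.
have gn k : (size l < k)%N -> g`_k = 0 by move=> ?; rewrite nth_default ?sg.
have gl : g`_(size l).-1 = - \sum_(a <- l) a.
  by rewrite coefPn_prod_XsubC -?lt0n.
have coefE k : (polar_deriv (size l) w g)`_k =
   (size l)%:R * g`_k + w * (g`_k.+1 *+ k.+1) - g`_k *+ k.
  rewrite coefD coefZ mulrBl coefB coefCM coefXM !coef_deriv.
  by case: k => [|k] /=; rewrite -?addrA ?mulr0n ?subr0.
apply/eqP; rewrite eqn_leq; apply/andP; split.
  apply/leq_sizeP => j; rewrite leq_eqVlt => /predU1P[<-|lj].
    by rewrite coefE (gn (size l).+1) // mul0rn mulr0 addr0 g1 mulr1 subrr.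
  by rewrite coefE !gn ?leqW // !mul0rn !mulr0 subr0 addr0.
have: (polar_deriv (size l) w g)`_(size l).-1 != 0.
  rewrite coefE prednK // g1 mulrnAr mulr1.
  have -> : (size l)%:R * g`_(size l).-1 + w *+ size l
     - g`_(size l).-1 *+ (size l).-1 = \sum_(a <- l) (w - a).
    rewrite big_split /= sumrN -gl big_const_seq count_predT iter_addr_0.
    rewrite -{1}(prednK l0) mulrSr mulrDl mul1r mulr_natl addrC -!addrA.
    by ring.
  apply/eqP => /(congr1 (fun z => complex.Re (u * z))).
  rewrite mulr_sumr Re_sum mulr0 /=; apply/eqP.
  rewrite lt_eqF //.
  case: (l) l0 lc => // a l' _ lc; rewrite big_cons.
  apply: ltr_wnDr; last first.
    by rewrite mulrBr ReB subr_lt0 (lt_le_trans wc) ?lc ?mem_head.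
  rewrite big_seq; apply: sumr_le0 => b bl.
  by rewrite mulrBr ReB subr_le0 ltW // (lt_le_trans wc) ?lc ?inE ?bl ?orbT.
by apply: contraR; rewrite -ltnNge => h; rewrite nth_default // -ltnS prednK.
Qed.

End PolarDerivative.

(** * Grace's theorem for a half-plane, and critical points *)

Section Grace.
Context {R : rcfType}.
Local Notation C := R[i].
Implicit Types (u w : C) (c : R) (t : nat -> C).

(** For the linear functional [T] with [T ('X^j) = t j], this is the polynomial
    [x |-> T (('X - x) ^+ n)]; it determines [T] in degrees up to [n]. *)
Definition umbral_poly (n : nat) (t : nat -> C) : {poly C} :=
  \poly_(k < n.+1) ((-1) ^+ k * 'C(n, k)%:R * t (n - k)%N).

(** If [T ('X^j) = t j], the right-hand side belongs to the functional
    [q |-> T (('X - w) q)]. So applying [T] to a product amounts to taking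
    successive polar derivatives with poles at the zeros of this product. *)
Lemma polar_deriv_umbral n w t :
  polar_deriv n.+1 w (umbral_poly n.+1 t) =
  n.+1%:R *: umbral_poly n (fun j => t j.+1 - w * t j).
Proof.
apply/polyP => k; rewrite coefD !coefZ mulrBl coefB coefCM coefXM !coef_deriv.
have -> : (if k == 0%N then 0 else (umbral_poly n.+1 t)`_k.-1.+1 *+ k.-1.+1)
  = (umbral_poly n.+1 t)`_k *+ k by case: k.
rewrite !coef_poly !ltnS.
have [kn|nk] := leqP k n; last first.
  rewrite mulr0; move: nk; rewrite leq_eqVlt => /predU1P[<-|nk].
    by rewrite leqnn mulr_natl mul0rn mulr0 sub0r subrr.
  by rewrite leqNgt nk /= !(mulr0, mul0rn, subrr, addr0).
rewrite leqW // subSS subSn // mulrBr.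
have E1 : (n.+1%:R - k%:R) * 'C(n.+1, k)%:R = n.+1%:R * 'C(n, k)%:R :> C.
  by rewrite -natrB ?leqW // -!natrM -mul_bin_down.
have E2 : k.+1%:R * 'C(n.+1, k.+1)%:R = n.+1%:R * 'C(n, k)%:R :> C.
  by rewrite -!natrM -mul_bin_diag.
rewrite -(mulr_natr _ k) -(mulr_natr _ k.+1) exprS.
transitivity ((-1) ^+ k * t (n - k).+1 * ((n.+1%:R - k%:R) * 'C(n.+1, k)%:R)
   - w * (-1) ^+ k * t (n - k)%N * (k.+1%:R * 'C(n.+1, k.+1)%:R)).
  by ring.
by rewrite E1 E2; ring.
Qed.

(** Grace's apolarity theorem when the zeros of the two polynomials are
    separated by a line. The zeros [w] are removed one at a time, each of them
    turning the functional into one whose polynomial is a polar derivative of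
    the previous one; Laguerre's theorem keeps the zeros on their side of the
    line. *)
Lemma grace_halfplane u c (ws : seq C) t :
  (forall w, w \in ws -> complex.Re (u * w) < c) ->
  size (umbral_poly (size ws) t) = (size ws).+1 ->
  (forall a, root (umbral_poly (size ws) t) a -> c <= complex.Re (u * a)) ->
  \sum_(j < (size ws).+1) (\prod_(w <- ws) ('X - w%:P))`_j * t j != 0.
Proof.
elim: ws t => [|w ws IH] t wsH gsize groot.
  rewrite big_nil big_ord1 coef1 mul1r.
  move: gsize; rewrite /umbral_poly /= => gsize.
  have : lead_coef (umbral_poly 0 t) != 0.
    by rewrite lead_coef_eq0 -size_poly_eq0 gsize.
  by rewrite lead_coefE gsize coef_poly /= !mul1r.
set n := size ws in IH gsize groot *.
pose t1 j := t j.+1 - w * t j.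
have -> : \sum_(j < (size (w :: ws)).+1)
     (\prod_(v <- w :: ws) ('X - v%:P))`_j * t j
   = \sum_(j < n.+1) (\prod_(v <- ws) ('X - v%:P))`_j * t1 j.
  rewrite big_cons [size _]/= -/n; set q := \prod_(v <- ws) _.
  have qn : q`_n.+1 = 0 by rewrite nth_default // /q size_prod_XsubC.
  have E j : (('X - w%:P) * q)`_j * t j
      = (if j == 0%N then 0 else q`_j.-1 * t j) - q`_j * (w * t j).
    rewrite mulrBl coefB coefXM coefCM mulrBl.
    by case: j => [|j] /=; ring.
  under eq_bigr do rewrite E.
  rewrite sumrB [X in X - _]big_ord_recl /= add0r.
  rewrite [X in _ - X]big_ord_recr /= qn mul0r addr0 -sumrB.
  by apply: eq_bigr => j _; rewrite mulrBr.
have [a gE] := closed_field_poly_normal (umbral_poly n.+1 t).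
set g := umbral_poly n.+1 t in gE gsize groot.
have g0 : g != 0 by rewrite -size_poly_eq0 gsize.
have lg0 : lead_coef g != 0 by rewrite lead_coef_eq0.
have sa : size a = n.+1.
  by apply: succn_inj; rewrite -gsize gE size_scale // size_prod_XsubC.
have aK b : b \in a -> c <= complex.Re (u * b).
  by move=> ba; apply: groot; rewrite gE rootZ // root_prod_XsubC.
have wH : complex.Re (u * w) < c by rewrite wsH ?mem_head.
have a0 : (0 < size a)%N by rewrite sa.
have g1E : umbral_poly n t1 = (n.+1%:R^-1 * lead_coef g) *:
    polar_deriv (size a) w (\prod_(b <- a) ('X - b%:P)).
  rewrite sa -scalerA -polar_derivZ -gE polar_deriv_umbral scalerA.
  by rewrite mulVf ?scale1r // pnatr_eq0.
have k0 : n.+1%:R^-1 * lead_coef g != 0.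
  by rewrite mulf_neq0 // invr_eq0 pnatr_eq0.
apply: IH.
- by move=> v vws; apply: wsH; rewrite inE vws orbT.
- by rewrite g1E size_scale // (@laguerre_size _ u c).
- by move=> b; rewrite g1E rootZ //; apply: laguerre_root.
Qed.

Lemma expr_subX_poly (x : C) m :
  (x%:P - 'X) ^+ m = \poly_(i < m.+1) ((-1) ^+ i * 'C(m, i)%:R * x ^+ (m - i)).
Proof.
rewrite exprBn poly_def; apply: eq_bigr => i _.
rewrite -mul_polyC !rmorphM /= !rmorphXn /= rmorphN rmorph1 rmorph_nat.
by rewrite -mulr_natr; ring.
Qed.

(** A complex substitute for Rolle's theorem: if [p] takes the same value at
    [x] and [y], no line that separates the critical points strictly from [x]
    can be the perpendicular bisector of [x] and [y]. Indeed [p.[x] - p.[y]]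
    is a linear functional of [p^`()] whose polynomial is, up to a factor,
    [(x - 'X) ^+ n - (y - 'X) ^+ n] for [n] the degree of [p]. All its zeros
    are equidistant from [x] and [y], that is, they lie on the bisector, and
    Grace's theorem applies. *)
Lemma root_deriv_bisector (p : {poly C}) (x y : C) :
  x != y -> p.[x] = p.[y] -> p^`() != 0 ->
  exists2 w, root p^`() w & `|w - x| <= `|w - y|.
Proof.
move=> xy pxy dp0.
have [ws dpE] := closed_field_poly_normal p^`().
set k := lead_coef p^`() in dpE.
have k0 : k != 0 by rewrite lead_coef_eq0.
have Hroot w : w \in ws -> root p^`() w.
  by move=> wws; rewrite dpE rootZ // root_prod_XsubC.
apply/not_exists2P => nex.
set n := size ws in Hroot.
have sdp : size p^`() = n.+1 by rewrite dpE size_scale // size_prod_XsubC.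
have sp : (size p <= n.+2)%N.
  apply/leq_sizeP => -[//|j] nj.
  have /eqP : p^`()`_j = 0 by rewrite nth_default ?sdp.
  by rewrite coef_deriv mulrn_eq0 => /eqP.
(* |w - y|^2 - |w - x|^2 = 2 Re (u w) - 2 c *)
pose u : C := (x - y)^*.
pose c : R := (complex.Re x ^+ 2 + complex.Im x ^+ 2 - complex.Re y ^+ 2
                - complex.Im y ^+ 2) / 2.
have bis w : (`|w - x| <= `|w - y|) = (c <= complex.Re (u * w)).
  rewrite -ler_sqr ?nnegrE // -!add_Re2_Im2 lecR /u /c.
  case: w x y {xy pxy nex u c} => [w1 w2] [x1 x2] [y1 y2] /=.
  by apply/idP/idP; lra.
(* [t j] is the integral of [X^j] from [y] to [x]. *)
pose t j : C := (x ^+ j.+1 - y ^+ j.+1) / j.+1%:R.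
have gE : n.+1%:R *: umbral_poly n t =
    (x%:P - 'X) ^+ n.+1 - (y%:P - 'X) ^+ n.+1.
  rewrite !expr_subX_poly; apply/polyP => i.
  rewrite coefZ coefB !coef_poly !ltnS.
  have [ni|] := leqP i n; last first.
    rewrite mulr0 leq_eqVlt => /predU1P[<-|ni]; last by rewrite leqNgt ni subrr.
    by rewrite leqnn subnn !expr0 subrr.
  rewrite leqW // subSn // /t.
  have E : n.+1%:R * 'C(n, i)%:R = (n - i).+1%:R * 'C(n.+1, i)%:R :> C.
    by rewrite -!natrM mul_bin_down subSn.
  set v := _ - _; set b := 'C(n, i)%:R in E *.
  have -> : n.+1%:R * ((-1) ^+ i * b * (v / (n - i).+1%:R)) =
    (-1) ^+ i * (n.+1%:R * b) * (v / (n - i).+1%:R) by ring.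
  have : (n - i).+1%:R != 0 :> C by rewrite pnatr_eq0.
  by rewrite E /v; move: ((n - i).+1%:R) => d d0; field.
have : \sum_(j < n.+1) (\prod_(w <- ws) ('X - w%:P))`_j * t j = 0.
  apply: (mulfI k0); rewrite mulr0 mulr_sumr.
  move/eqP: pxy; rewrite -subr_eq0 !(horner_coef_wide _ sp) -sumrB.
  rewrite big_ord_recl /=.
  rewrite !expr0 subrr add0r => /eqP E; rewrite -[RHS]E {E}.
  apply: eq_bigr => j _; rewrite mulrA -coefZ -dpE coef_deriv -mulrBr /t.
  have : j.+1%:R != 0 :> C by rewrite pnatr_eq0.
  rewrite /bump /= add1n -(mulr_natr p`_j.+1 j.+1).
  by move: (j.+1%:R) => d d0; field.
apply/eqP; apply: (@grace_halfplane u c).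
- move=> w /Hroot rw; rewrite ltNge -bis; apply/negP => ?.
  by case: (nex w).
- rewrite size_poly_eq // subnn binn mulr1 mulf_neq0 ?signr_eq0 //.
  by rewrite /t !expr1 divr1 subr_eq0.
- move=> a; have n0 : n.+1%:R != 0 :> C by rewrite pnatr_eq0.
  rewrite -bis -(rootZ a _ n0) gE rootE !hornerE.
  rewrite subr_eq0 => /eqP /(congr1 (fun z => `|z|)).
  rewrite !normrX => /eqP; rewrite eqrXn2 // => /eqP E.
  by rewrite distrC E distrC.
Qed.
End Grace.

(** * Rolle's theorem with multiplicities *)

Section Rolle.

Lemma dvdp_prod_XsubC_count (F : fieldType) (l : seq F) (g : {poly F}) :
  g != 0 -> (forall x, x \in l -> (count_mem x l <= mup x g)%N) ->
  \prod_(a <- l) ('X - a%:P) %| g.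
Proof.
elim: l g => [|a l IH] g g0 lg; first by rewrite big_nil dvd1p.
have : ('X - a%:P) %| g.
  rewrite XsubC_dvd //; apply: leq_trans (lg a (mem_head _ _)).
  by rewrite /= eqxx.
case/dvdpP => h gE; move: g0 lg; rewrite gE big_cons [X in X %| _]mulrC.
rewrite mulf_eq0 negb_or => /andP[h0 X0] lg.
rewrite dvdp_mul2r //; apply: IH => // x xl.
have := lg x; rewrite inE xl orbT => /(_ isT).
by rewrite mupM // (@mup_XsubCX _ 1) /= addnC leq_add2r.
Qed.

Lemma mup_deriv (F : fieldType) (a : F) (f : {poly F}) k :
  f != 0 -> f^`() != 0 -> (k.+1 <= mup a f)%N -> (k <= mup a f^`())%N.
Proof.
move=> f0 df0; rewrite !mup_geq // => /dvdpP[h ->].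
rewrite derivM; apply: dvdp_add; first by rewrite dvdp_mull // exprS dvdp_mulIr.
by rewrite deriv_exp -mulr_natr -!mulrA dvdp_mull // dvdp_mull // dvdp_mulIl.
Qed.

Variable R : rcfType.
(** The points found are new and distinct, so that their multiplicities can be
    added to those that the zeros of [f] keep in the derivative. *)
Lemma rolle_path (x : R) (l : seq R) (f : {poly R}) :
  path <%R x l -> (forall y, y \in x :: l -> root f y) ->
  exists ys : seq R, [/\ size ys = size l, uniq ys &
    forall y, y \in ys -> [/\ x < y, y < last x l, y \notin x :: l
      & root f^`() y]].
Proof.
elim: l x => [|x1 l IH] x /=; first by exists [::].
case/andP => xx1 pl rf.
have [||ys [sys uys ysP]] := IH x1 => //.
  by move=> y yl; apply: rf; rewrite inE yl orbT.
have [||y yin dy] := @polyrcf.poly_rolle _ x x1 f => //.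
  by rewrite !(rootP (rf _ _)) // !inE eqxx ?orbT.
move: yin; rewrite in_itv /= => /andP[xy yx1].
have x1l z : z \in x1 :: l -> x1 <= z.
  rewrite inE => /predU1P[->|] //; move: pl; rewrite lt_path_sortedE.
  by case/andP => /allP al _ /al /ltW.
exists (y :: ys); split; first by rewrite /= sys.
  by rewrite /= uys andbT; apply/negP => /ysP[/(lt_trans yx1)]; rewrite ltxx.
move=> z; rewrite inE => /predU1P[->|/ysP[x1z zl zx1 dz]].
  split=> //; first by apply: lt_le_trans (x1l _ (mem_last _ _)).
  - rewrite inE negb_or gt_eqF //=; apply/negP => /x1l.
    by rewrite leNgt yx1.
  - by apply/rootP.
split => //; first exact: lt_trans x1z.
by rewrite inE negb_or zx1 gt_eqF // (lt_trans xx1).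
Qed.

(** A zero of multiplicity [k] survives in the derivative with multiplicity
    [k - 1], and one more zero appears between two consecutive distinct ones:
    exactly one zero is lost. *)
Lemma rolle_multiplicity (b : R) (l : seq R) (f : {poly R}) :
  (0 < size l)%N -> f^`() != 0 -> (forall a, a \in l -> `|a| <= b) ->
  \prod_(a <- l) ('X - a%:P) %| f ->
  exists t : seq R, [/\ size t = (size l).-1, forall a, a \in t -> `|a| <= b
    & \prod_(a <- t) ('X - a%:P) %| f^`()].
Proof.
move=> l0 df0 lb lf.
have f0 : f != 0 by apply: contra_neq df0 => ->; rewrite deriv0.
have cf x : (count_mem x l <= mup x f)%N.
  rewrite mup_geq // -mu_prod_XsubC; apply: dvdp_trans lf.
  by rewrite -mup_geq ?monic_neq0 ?monic_prod_XsubC.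
have : uniq (sort <=%R (undup l)) by rewrite sort_uniq undup_uniq.
have : sorted <%R (sort <=%R (undup l)).
  by rewrite lt_sorted_uniq_le sort_uniq undup_uniq /= sort_le_sorted.
have memu y : (y \in sort <=%R (undup l)) = (y \in l).
  by rewrite mem_sort mem_undup.
have : size (sort <=%R (undup l)) = size (undup l) by rewrite size_sort.
case: (sort _ _) memu => [|x u] memu su.
  by case: (l) l0 memu => // y l' _ /(_ y); rewrite mem_head.
move=> /= pu _.
have [||ys [sys uys ysP]] := @rolle_path x u f => //.
  move=> y; rewrite memu => yl; apply/rootP/eqP; rewrite -rootE.
  rewrite -dvdp_XsubCl XsubC_dvd //; apply: leq_trans (cf y).
  by rewrite -has_count has_pred1.
(* [s2] lists every zero one time less than [l] does. *)
have [s2 perm2] := perm_to_subseq (undup_subseq l).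
exists (ys ++ s2); split.
- rewrite size_cat sys (perm_size perm2) size_cat -su /=. by [].
- move=> a; rewrite mem_cat => /orP[/ysP[xa al _ _]|as2]; last first.
  by apply: lb; rewrite (perm_mem perm2) mem_cat as2 orbT.
  have /lb : x \in l by rewrite -memu mem_head.
  have /lb : last x u \in l by rewrite -memu mem_last.
  rewrite !ler_norml => /andP[_ ub] /andP[lo _].
  by rewrite (le_trans lo (ltW xa)) (le_trans (ltW al)).
apply: dvdp_prod_XsubC_count => // y yt.
rewrite count_cat.
have := perm2; move=> /permP/(_ (pred1 y)); rewrite count_cat => cy.
have cu : count_mem y (undup l) = (y \in l).
  by rewrite count_uniq_mem ?undup_uniq // mem_undup.
have [yl|yl] := boolP (y \in l).
  have -> : count_mem y ys = 0%N.
    by apply/count_memPn/negP => /ysP[_ _]; rewrite memu yl.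
  move: cy; rewrite cu yl add1n add0n => cy.
  by apply: mup_deriv => //; apply: leq_trans (cf y); rewrite cy.
have -> : count_mem y s2 = 0%N.
  by move: cy; rewrite (count_memPn yl) cu (negPf yl) add0n.
rewrite addn0 count_uniq_mem //; case: (boolP (y \in ys)) => // /ysP[_ _ _].
by rewrite -dvdp_XsubCl XsubC_dvd.
Qed.

End Rolle.

(** * Zeros of iterated primitives *)

Section Primitives.
Variable R : rcfType.
Local Notation C := R[i].
Local Notation toC := (map_poly (real_complex R)).
Implicit Types (f g : {poly R}) (b B : R) (l : seq R).

Definition roots_in_disk B f := forall z : C, root (toC f) z -> `|z| <= B%:C.

(** For a zero [z] other than [x], some critical point [w] is at most as far
    from [z] as from [x], hence [|z| <= |w| + |w - x| <= 3 B]. This is where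
    the factor 3 per integration comes from. *)
Lemma roots_in_disk_primitive B f (x : R) :
  root f x -> `|x| <= B -> f^`() != 0 -> roots_in_disk B f^`() ->
  roots_in_disk (3 * B) f.
Proof.
move=> fx xB df0 dfB z fz.
have xBC : `|x%:C| <= B%:C.
  by rewrite normc_def /= expr0n addr0 sqrtr_sqr lecR.
have BC0 : 0 <= B%:C by apply: le_trans xBC.
have B3 : (3 * B)%:C = B%:C + (B%:C + B%:C).
  by rewrite -!rmorphD /=; congr (_ %:C); ring.
rewrite B3.
have [->|zx] := eqVneq z x%:C.
  by rewrite (le_trans xBC) // lerDl addr_ge0.
have [|||w rw wzx] := @root_deriv_bisector R (toC f) z x%:C => //.
- by rewrite (rootP fz) horner_map (rootP fx) rmorph0.
- by rewrite deriv_map map_poly_eq0.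
have wB : `|w| <= B%:C by apply: dfB; rewrite -deriv_map.
rewrite -(subrKC w z) (le_trans (ler_normD _ _)) // lerD //.
rewrite distrC (le_trans wzx) // (le_trans (ler_normB _ _)) // lerD //.
Qed.

(** As long as enough real zeros are known, Rolle's theorem provides each of the
    successive primitives with a real zero, which fixes the constant of
    integration. *)
Lemma derivn_zeros b l k f :
  (k <= size l)%N -> f^`(k) != 0 -> (forall a, a \in l -> `|a| <= b) ->
  \prod_(a <- l) ('X - a%:P) %| f ->
  exists t : seq R, [/\ size t = (size l - k)%N,
    forall a, a \in t -> `|a| <= b,
    \prod_(a <- t) ('X - a%:P) %| f^`(k)
    & forall B, b <= B -> roots_in_disk B f^`(k) ->
        roots_in_disk (3 ^+ k * B) f].
Proof.
elim: k l f => [|k IH] l f kl dk0 lb lf.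
  exists l; rewrite subn0; split => // B _; by rewrite expr0 mul1r.
have d0 : f^`() != 0.
  by apply: contra_neq dk0 => d0; rewrite derivSn d0 linear0.
have l0 : (0 < size l)%N by apply: leq_trans kl.
have [t [st tb tf]] := rolle_multiplicity l0 d0 lb lf.
rewrite derivSn in dk0 *.
have [|s [ss sb sf sB]] := IH t f^`() _ dk0 tb tf.
  by rewrite st -ltnS prednK.
exists s; split => //; first by rewrite ss st -subn1 -subnDA.
move=> B bB /(sB _ bB) df.
case: (l) l0 lb lf => // x l' _ lb lf.
have xb : `|x| <= b by apply: lb; rewrite mem_head.
rewrite exprS -mulrA; apply: (@roots_in_disk_primitive _ _ x) => //.
  rewrite -dvdp_XsubCl; apply: dvdp_trans lf.
  by rewrite big_cons dvdp_mulIl.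
apply: le_trans (le_trans xb bB) _; rewrite ler_peMl //.
  by rewrite (le_trans _ (le_trans xb bB)).
by rewrite exprn_ege1 // ler1n.
Qed.

(** The hypothesis on the prefixes of [ix] is the balance of known real zeros:
    multiplying by a factor adds its zeros, and each differentiation costs one,
    so there is one left whenever one has to be paid. It also keeps all the
    iterates nonzero, because a nonzero polynomial with [k] zeros has degree at
    least [k] and is not killed by [k] differentiations. *)
Lemma roots_in_disk_iterated (I : eqType) (zs : I -> seq R) (nn : I -> nat)
    b (ix : seq I) l f :
  0 <= b -> f != 0 -> (forall a, a \in l -> `|a| <= b) ->
  (forall j a, a \in zs j -> `|a| <= b) ->
  \prod_(a <- l) ('X - a%:P) %| f ->
  (forall ix1 ix2, ix = ix1 ++ ix2 ->
     (\sum_(j <- ix1) nn j <= size l + \sum_(j <- ix1) size (zs j))%N) ->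
  let g := foldl (fun q j => ((\prod_(a <- zs j) ('X - a%:P)) * q)^`(nn j))
             f ix in
  g != 0 /\ forall B, b <= B -> roots_in_disk B g ->
     roots_in_disk (3 ^+ (\sum_(j <- ix) nn j) * B) f.
Proof.
elim: ix l f => [|j ix IH] l f b0 f0 lb zb lf pre /=.
  by split => // B _; rewrite big_nil expr0 mul1r.
set p := \prod_(a <- zs j) _.
have p0 : p != 0 by rewrite monic_neq0 // monic_prod_XsubC.
have lz : \prod_(a <- zs j ++ l) ('X - a%:P) %| p * f.
  by rewrite big_cat /= dvdp_mul.
have lzb a : a \in zs j ++ l -> `|a| <= b.
  by rewrite mem_cat => /orP[/zb|/lb].
have pf0 : p * f != 0 by rewrite mulf_neq0.
have nj : (nn j <= size (zs j ++ l))%N.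
  have := pre [:: j] ix erefl; rewrite !big_seq1 size_cat addnC; exact.
have dn0 : (p * f)^`(nn j) != 0.
  rewrite -polyorder.derivn_poly0 -ltnNge; apply: leq_ltn_trans nj _.
  by have := dvdp_leq pf0 lz; rewrite size_prod_XsubC.
have [t [st tb tf tB]] := derivn_zeros nj dn0 lzb lz.
have [|g0 gB] := IH t _ b0 dn0 tb zb tf.
  move=> ix1 ix2 ixE; have := pre (j :: ix1) ix2; rewrite ixE => /(_ erefl).
  rewrite !big_cons st size_cat; move: nj; rewrite size_cat.
  by move: (\sum_(i <- _) _)%N (\sum_(i <- _) _)%N => u v; lia.
split => // B bB gBd; rewrite big_cons exprD -mulrA.
move=> z fz; apply: (tB (3 ^+ (\sum_(i <- ix) nn i) * B)).
- apply: (le_trans bB); apply: ler_peMl; first exact: (le_trans b0 bB).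
  by rewrite exprn_ege1 // ler1n.
- exact: gB.
- by rewrite rmorphM rootM fz orbT.
Qed.

End Primitives.

(** * Zeros of orthogonal polynomials *)

Section PolynomialIntegrals.
Import measurable_realfun.
Context {R : realType}.
Local Notation C := R[i].
Local Notation toC := (map_poly (real_complex R)).
Variable mu : {finite_measure set (measurableTypeR R) -> \bar R}.
Implicit Types (u : {poly R}) (p q : {poly C}).

Lemma integrable_poly u : has_moments mu ->
  mu.-integrable setT (fun x : R => (u.[x])%:E).
Proof.
move=> hm.
apply: (@eq_integrable _ _ _ mu setT measurableT
  (fun x : R => \sum_(i < size u) (u`_i)%:E * (x ^+ i)%:E)%E).
  by move=> x _; rewrite horner_coef -sumEFin.
apply: integrable_sum => // i _.
by apply: integrableZl; [exact: measurableT | exact: (hm i)].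
Qed.

Lemma Rintegral_sum_moments n (c : nat -> R) : has_moments mu ->
  Rintegral mu setT (fun x => \sum_(i < n) c i * x ^+ i)
  = \sum_(i < n) c i * moment mu i.
Proof.
move=> hm; elim: n => [|n IH].
  have -> : (fun x : R => \sum_(i < 0) c i * x ^+ i) = cst 0.
    by apply/funext => x; rewrite big_ord0.
  rewrite big_ord0.
  by rewrite Rintegral_cst // mul0r.
have -> : (fun x : R => \sum_(i < n.+1) c i * x ^+ i) =
    (fun x => \sum_(i < n) c i * x ^+ i + c n * x ^+ n).
  by apply/funext => x; rewrite big_ord_recr.
rewrite big_ord_recr /= -IH.
have Eh (x : R) : \sum_(i < n) c i * x ^+ i = (\poly_(i < n) c i).[x].
  by rewrite horner_poly.
rewrite RintegralD //.
- by rewrite RintegralZl //; exact: hm.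
- apply: (@eq_integrable _ _ _ mu setT measurableT _ _ _
    (integrable_poly (\poly_(i < n) c i) hm)).
  by move=> x _ /=; rewrite Eh.
- exact: (@integrableZl _ _ _ mu setT measurableT (c n) _ (hm n)).
Qed.

Lemma Cintegral_poly p n : has_moments mu -> (size p <= n)%N ->
  Cintegral mu (fun x => p.[x%:C]) = \sum_(i < n) p`_i * (moment mu i)%:C.
Proof.
move=> hm pn.
have ReM (z : C) (x : R) : complex.Re (z * x%:C) = complex.Re z * x.
  by case: z => ? ?; rewrite /= mulr0 subr0.
have ImM (z : C) (x : R) : complex.Im (z * x%:C) = complex.Im z * x.
  by case: z => ? ?; rewrite /= mulr0 add0r.
rewrite /Cintegral.
have -> : (fun x : R => complex.Re p.[x%:C])
   = (fun x => \sum_(i < n) complex.Re p`_i * x ^+ i).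
  apply/funext => x; rewrite (horner_coef_wide _ pn) Re_sum.
  by apply: eq_bigr => i _; rewrite -rmorphXn ReM.
have -> : (fun x : R => complex.Im p.[x%:C])
   = (fun x => \sum_(i < n) complex.Im p`_i * x ^+ i).
  apply/funext => x; rewrite (horner_coef_wide _ pn) Im_sum.
  by apply: eq_bigr => i _; rewrite -rmorphXn ImM.
rewrite !(Rintegral_sum_moments n (fun i => complex.Re p`_i)) //.
rewrite !(Rintegral_sum_moments n (fun i => complex.Im p`_i)) //.
apply/eqP; rewrite eq_complex /= Re_sum Im_sum.
apply/andP; split; apply/eqP; apply: eq_bigr => i _; first by rewrite ReM.
by rewrite ImM.
Qed.

Lemma Cintegral_conj p : has_moments mu ->
  Cintegral mu (fun x => (map_poly conjc p).[x%:C]) =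
  (Cintegral mu (fun x => p.[x%:C]))^*.
Proof.
move=> hm; rewrite !(@Cintegral_poly _ (size p)) ?size_map_poly //.
rewrite rmorph_sum; apply: eq_bigr => i _.
by rewrite coef_map [in RHS]rmorphM /= oppr0.
Qed.

Lemma CintegralZ k p : has_moments mu ->
  Cintegral mu (fun x => (k *: p).[x%:C]) =
  k * Cintegral mu (fun x => p.[x%:C]).
Proof.
move=> hm; rewrite !(@Cintegral_poly _ (size p)) ?size_scale_leq //.
by rewrite mulr_sumr; apply: eq_bigr => i _; rewrite coefZ mulrA.
Qed.

Lemma CintegralD p q : has_moments mu ->
  Cintegral mu (fun x => (p + q).[x%:C]) =
  Cintegral mu (fun x => p.[x%:C]) + Cintegral mu (fun x => q.[x%:C]).
Proof.
move=> hm; set n := maxn (size p) (size q).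
rewrite !(@Cintegral_poly _ n) ?leq_maxl ?leq_maxr //;
  last exact: leq_trans (size_polyD _ _) _.
by rewrite -big_split /=; apply: eq_bigr => i _; rewrite coefD mulrDl.
Qed.

Lemma Cintegral_real u : has_moments mu ->
  Cintegral mu (fun x => (toC u).[x%:C]) =
  (Rintegral mu setT (fun x => u.[x]))%:C.
Proof.
move=> hm; rewrite /Cintegral.
under eq_Rintegral do rewrite horner_map /=.
rewrite -[X in _ +i* X](_ : 0 = _) // (_ : (fun x : R => complex.Im _) = cst 0).
  by rewrite Rintegral_cst // mul0r.
by apply/funext => x; rewrite horner_map.
Qed.

(** Every point outside the support has a neighbourhood with rational endpoints
    that is a null set, and there are countably many of these. *)
Lemma measure_outside_support (a b : R) :
  msupport mu `<=` [set x : R | a <= x <= b] ->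
  mu.-negligible (~` [set x : R | a <= x <= b]).
Proof.
move=> sub.
pose I (q : rat * rat) : set (measurableTypeR R) :=
  `]ratr q.1, ratr q.2[%classic.
pose F n : set (measurableTypeR R) :=
  if unpickle n is Some q then (if mu (I q) == 0%E then I q else set0)
  else set0.
have negF n : mu.-negligible (F n).
  rewrite /F; case: (unpickle n) => [q|]; last exact: negligible_set0.
  case: ifPn => [/eqP h|_]; last exact: negligible_set0.
  by apply/negligibleP => //; exact: measurable_itv.
apply: negligibleS (negligible_bigcup negF) => x /= xab.
have : ~ msupport mu x by move/sub.
move=> /existsNP[U /not_implyP[oU /not_implyP[Ux /negP]]].
rewrite -leNgt => muU.
have [e /= e0 eU] := (nbhs_ballP _ _).1 (open_nbhs_nbhs (conj oU Ux)).
have [xl xr] : x - e < x /\ x < x + e by rewrite ltrBlDr ltrDl.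
have [q1 q1P] := rat_in_itvoo xl; have [q2 q2P] := rat_in_itvoo xr.
move: q1P q2P; rewrite !in_itv /= => /andP[q1e q1x] /andP[xq2 q2e].
exists (pickle (q1, q2)); [by [] | rewrite /F pickleK].
have sU : I (q1, q2) `<=` U.
  move=> y; rewrite /I /= in_itv /= => /andP[qy yq]; apply: eU.
  by rewrite /ball /= distrC ltr_distl (lt_trans q1e qy) (lt_trans yq).
rewrite ifT; first by rewrite /I /= in_itv /= q1x.
rewrite -measure_le0; apply: le_trans muU; apply: le_measure => //; rewrite inE.
  exact: measurable_itv.
exact: open_measurable.
Qed.

(** If the integral vanished, [u] would vanish almost everywhere, the support
    would lie in its zero set, and this set is finite. *)
Lemma Rintegral_poly_gt0 u : has_moments mu -> infinite_set (msupport mu) ->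
  msupport mu `<=` [set x : R | -1 <= x <= 1] -> u != 0 ->
  (forall x : R, -1 <= x <= 1 -> 0 <= u.[x]) ->
  0 < Rintegral mu setT (fun x => u.[x]).
Proof.
move=> hm infs sub u0 upos.
have iu := integrable_poly u hm.
have mu_ := measurable_int mu iu.
have Eabs : (\int[mu]_x (u.[x])%:E = \int[mu]_x `|(u.[x])%:E|)%E.
  apply: ae_eq_integral; first exact: measurableT.
  - exact: mu_.
  - exact: measurableT_comp mu_.
  have [N [mN N0 NS]] := measure_outside_support sub.
  exists N; split => //; apply: subset_trans NS => x /= h xab; apply: h => _.
  by rewrite ger0_norm // upos.
have ge0 : (0 <= \int[mu]_x (u.[x])%:E)%E by rewrite Eabs integral_ge0.
have finu : (\int[mu]_x (u.[x])%:E)%E \is a fin_num.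
  exact: integrable_fin_num.
rewrite /Rintegral fine_gt0 // lt_neqAle ge0 andbT ltey_eq finu andbT.
apply/negP => /eqP /esym; rewrite Eabs => /ae_eq_integral_abs.
move=> /(_ measurableT mu_) [N [mN N0 NS]].
pose D := [set x : R | u.[x] != 0].
have oD : open D.
  have -> : D = (fun x : R => u.[x]) @^-1` [set~ 0].
    by apply/seteqP; split => x /= /eqP.
  apply: open_comp; last by apply: closed_openC; exact: closed_eq.
  by move=> x _; exact: continuous_horner.
have DN : D `<=` N.
  by move=> x ux; apply: NS => /= /(_ I) [] /eqP; apply/negP.
have muD : mu D = 0%E.
  apply/eqP; rewrite -measure_le0 -N0.
  by apply: le_measure; rewrite ?inE //; exact: open_measurable.
apply: infs; apply: (@sub_finite_set _ _ [set` polyrcf.rootsR u]);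
  last exact: finite_seq.
move=> x sx /=.
suff ux : root u x by rewrite -(polyrcf.roots_on_rootsR u0) in_itv ux.
apply/negPn/negP => nux.
by have := sx D oD nux; rewrite muD ltxx.
Qed.

(** Write [p = ('X - z) h] and test [p] against the conjugate of [h]: this shows
    that [z] is the barycentre of the positive measure [|h|^2 d mu], which lives
    on [[-1, 1]]. *)
Lemma orthogonal_roots_in_disk n p z : has_moments mu ->
  infinite_set (msupport mu) -> msupport mu `<=` [set x : R | -1 <= x <= 1] ->
  p != 0 -> (size p <= n.+1)%N ->
  (forall q, (size q <= n)%N ->
     Cintegral mu (fun x => p.[x%:C] * q.[x%:C]) = 0) ->
  root p z -> `|z| <= 1.
Proof.
move=> hm infs sub p0 sp orth rz.
have /factor_theorem[h pE] := rz.
have h0 : h != 0 by apply: contra_neq p0; rewrite pE => ->; rewrite mul0r.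
have sh : (size h <= n)%N.
  by move: sp; rewrite pE size_Mmonic ?monicXsubC // size_XsubC addn2.
pose hr := map_poly (@complex.Re R) h; pose hi := map_poly (@complex.Im R) h.
have hE : h = toC hr + 'i *: toC hi.
  apply/polyP => i; rewrite coefD coefZ !coef_map_id0 //.
  exact: complexE.
have hcE : map_poly conjc h = toC hr - 'i *: toC hi.
  apply/polyP => i; rewrite coefB coefZ coef_map !coef_map_id0 //.
  case: (h`_i) => a b /=; apply/eqP; rewrite eq_complex /=.
  by apply/andP; split; apply/eqP; ring.
pose w := hr ^+ 2 + hi ^+ 2.
have hhE : h * map_poly conjc h = toC w.
  rewrite hcE {1}hE /w rmorphD !rmorphXn /= -!mul_polyC.
  have i2 : ('i%:P : {poly C}) ^+ 2 = -1 by rewrite -rmorphXn /= sqr_i rmorphN.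
  transitivity (toC hr ^+ 2 - ('i%:P : {poly C}) ^+ 2 * toC hi ^+ 2).
    by ring.
  by rewrite i2 mulN1r opprK.
have w0 : w != 0.
  by rewrite -(map_poly_eq0 (real_complex R)) -hhE mulf_neq0 // map_poly_eq0.
have wpos x : 0 <= w.[x] by rewrite !hornerE addr_ge0 ?sqr_ge0.
pose e u := Rintegral mu setT (fun x => u.[x]).
have eB u v : e (u - v) = e u - e v.
  rewrite /e -RintegralB //; try exact: integrable_poly.
  by congr Rintegral; apply/funext => x; rewrite hornerD hornerN.
have eD u v : e (u + v) = e u + e v.
  rewrite /e -RintegralD //; try exact: integrable_poly.
  by congr Rintegral; apply/funext => x; rewrite hornerD.
have egt0 u : u != 0 -> (forall x : R, -1 <= x <= 1 -> 0 <= u.[x]) -> 0 < e u.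
  exact: Rintegral_poly_gt0.
have Ew : 0 < e w by apply: egt0.
(* [z] will be [e ('X * w) / e w]; the next two inequalities bound it. *)
have E1 : 0 < e w - e ('X * w).
  rewrite -eB -[X in e (X - _)]mul1r -mulrBl; apply: egt0.
    by rewrite mulf_neq0 // -opprB oppr_eq0 polyXsubC_eq0.
  by move=> x /andP[_ x1]; rewrite hornerM mulr_ge0 // !hornerE subr_ge0.
have E2 : 0 < e w + e ('X * w).
  rewrite -eD -[X in e (X + _)]mul1r -mulrDl; apply: egt0.
    by rewrite mulf_neq0 // addrC -[1]opprK -polyCN polyXsubC_eq0.
  by move=> x /andP[x1 _]; rewrite hornerM mulr_ge0 // !hornerE; lra.
have := orth (map_poly conjc h).
rewrite size_map_poly => /(_ sh).
have -> : (fun x : R => p.[x%:C] * (map_poly conjc h).[x%:C]) =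
    (fun x => (toC ('X * w) + (- z) *: toC w).[x%:C]).
  apply/funext => x; rewrite -hornerM pE mulrAC hhE mulrC mulrBl.
  by rewrite rmorphM /= map_polyX mul_polyC scaleNr.
rewrite CintegralD // CintegralZ // !Cintegral_real // -/(e _) -/(e _).
move/eqP; rewrite mulNr subr_eq0 => /eqP zE.
have {zE} -> : z = (e ('X * w) / e w)%:C.
  apply: (mulIf (_ : (e w)%:C != 0)); first by rewrite fmorph_eq0 gt_eqF.
  by rewrite -zE -rmorphM divfK // gt_eqF.
rewrite normc_def /= expr0n addr0 sqrtr_sqr -[1]/(1%:C) lecR.
rewrite normrM normfV [X in _ / X]gtr0_norm // ler_pdivrMr // mul1r ler_norml.
by apply/andP; split; lra.
Qed.
End PolynomialIntegrals.

(** * Factorized differential operators *)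

Section FactorizedOperators.
Context {R : realType}.
Local Notation C := R[i].
Local Notation toC := (map_poly (real_complex R)).

Lemma real_rooted_factorization (p : {poly C}) n :
  size p = n.+1 -> (forall z, root p z -> z \is Num.real) ->
  exists2 l : seq R, size l = n &
    p = lead_coef p *: toC (\prod_(a <- l) ('X - a%:P)).
Proof.
move=> sp rp; have [s pE] := closed_field_poly_normal p.
have p0 : p != 0 by rewrite -size_poly_eq0 sp.
have lp0 : lead_coef p != 0 by rewrite lead_coef_eq0.
have sr z : z \in s -> (complex.Re z)%:C = z.
  by move=> zs; apply/RRe_real/rp; rewrite pE rootZ // root_prod_XsubC.
exists [seq complex.Re z | z <- s].
  rewrite size_map; apply: succn_inj.
  by rewrite -sp pE size_scale // size_prod_XsubC.
rewrite {1}pE; congr (_ *: _).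
rewrite big_map rmorph_prod /= big_seq [RHS]big_seq.
by apply: eq_bigr => z /sr zE; rewrite rmorphB /= map_polyX map_polyC /= zE.
Qed.

Lemma diff_op_linear M (rho : nat -> {poly C}) : linear (diff_op M rho).
Proof.
move=> k p q; rewrite /diff_op scaler_sumr -big_split /=.
by apply: eq_bigr => i _; rewrite linearP mulrDr scalerAr.
Qed.

Lemma size_derivn_leq (F : nzRingType) (p : {poly F}) k :
  p^`(k) != 0 -> (size p^`(k) + k <= size p)%N.
Proof.
move=> dk0; have kp : (k < size p)%N.
  by rewrite ltnNge; apply: contra dk0 => /derivn_poly0 ->.
rewrite addnC -leq_subRL ?(ltnW kp) //.
apply/leq_sizeP => j; rewrite coef_derivn leq_subLR => pj.
by rewrite nth_default ?mul0rn.
Qed.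

Lemma size_diff_op M (rho : nat -> {poly C}) p :
  (forall k, (k <= M)%N -> (size (rho k) <= k.+1)%N) ->
  (size (diff_op M rho p) <= size p)%N.
Proof.
move=> srho; rewrite /diff_op.
apply: (leq_trans (size_sum _ _ _)); apply/bigmax_leqP => k _.
have [dk0|dk0] := eqVneq p^`(k) 0; first by rewrite dk0 mulr0 size_poly0.
have [r0|r0] := eqVneq (rho k) 0; first by rewrite r0 mul0r size_poly0.
rewrite size_mul //.
have := srho k; rewrite -ltnS ltn_ord => /(_ isT) sk.
have sd := size_derivn_leq dk0.
apply: leq_trans sd; rewrite -subn1 leq_subLR addnCA addnC leq_add2l.
exact: sk.
Qed.

Lemma dvdp_derivn_XsubC_exp (F : fieldType) (a : F) k n (p : {poly F}) :
  ('X - a%:P) ^+ n %| p -> ('X - a%:P) ^+ (n - k) %| p^`(k).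
Proof.
elim: k n p => [|k IH] n p; first by rewrite subn0.
case: n => [|n] /dvdpP[h pE]; first by rewrite sub0n expr0 dvd1p.
rewrite derivSn subSS; apply: IH; rewrite pE derivM dvdp_add //.
  by rewrite dvdp_mull // exprS dvdp_mulIr.
by rewrite deriv_exp /= -mulr_natr -!mulrA dvdp_mull // dvdp_mull // dvdp_mulIl.
Qed.

Lemma dvdp_diff_op_XsubC_exp M (rho : nat -> {poly C}) (a : C) n :
  ('X - a%:P) ^+ n %| diff_op M rho (('X - a%:P) ^+ (M + n)).
Proof.
rewrite /diff_op; elim/big_ind: _ => [|p q|k _]; first exact: dvdp0.
  exact: dvdp_add.
apply/dvdp_mull/(dvdp_trans _ (dvdp_derivn_XsubC_exp k (dvdpp _))).
have kM : (k <= M)%N by rewrite -ltnS ltn_ord.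
by apply: dvdp_exp2l; rewrite addnC -addnBA // leq_addr.
Qed.

Section Iterated.
Variables (I : eqType) (nn : I -> nat).
Implicit Types (r : I -> {poly C}) (ix : seq I) (p : {poly C}).

(** The composition of the factors taken along an arbitrary list of indices, in
    which the induction takes place; [iterated_op] is the case of [enum]. *)
Definition fold_op (F : nzRingType) (r : I -> {poly F}) (p : {poly F}) ix :=
  foldl (fun q j => (r j * q)^`(nn j)) p ix.

Lemma fold_op0 r ix : fold_op r 0 ix = 0.
Proof. by elim: ix => //= j ix IH; rewrite mulr0 linear0. Qed.

Lemma size_fold_op r ix p : fold_op r p ix != 0 ->
  (size (fold_op r p ix) + \sum_(j <- ix) nn j <=
   size p + \sum_(j <- ix) (size (r j)).-1)%N.
Proof.
have count_sizes a S d T n u v :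
    (a + S <= d + T)%N -> (d + n <= (u + v).-1)%N -> (0 < u)%N ->
    (a + (n + S) <= v + (u.-1 + T))%N by lia.
elim: ix p => [|j ix IH] p /=; first by rewrite !big_nil.
move=> q0; have sq := IH _ q0.
have d0 : (r j * p)^`(nn j) != 0.
  by apply: contra_neq q0 => ->; exact: fold_op0.
have rp0 : r j * p != 0 by apply: contra_neq d0 => ->; rewrite linear0.
have sd := size_derivn_leq d0.
move: rp0 sd; rewrite mulf_eq0 negb_or => /andP[r0 p0].
rewrite size_mul // => sd.
by rewrite !big_cons; apply: count_sizes sq sd _; rewrite size_poly_gt0.
Qed.

(** A polynomial whose degree would become negative on the way is killed,
    whatever the remaining factors do. *)
Lemma fold_op_kills r ix1 ix2 p :
  (size p + \sum_(j <- ix1) (size (r j)).-1 <= \sum_(j <- ix1) nn j)%N ->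
  fold_op r p (ix1 ++ ix2) = 0.
Proof.
move=> h; rewrite /fold_op foldl_cat -/(fold_op r p ix1).
suff -> : fold_op r p ix1 = 0 by exact: fold_op0.
apply/eqP/negPn/negP => q0; have := size_fold_op q0.
by move: q0; rewrite -size_poly_gt0; lia.
Qed.

Lemma fold_opZ r s (c : I -> C) k p ix : (forall j, r j = c j *: s j) ->
  fold_op r (k *: p) ix = (k * \prod_(j <- ix) c j) *: fold_op s p ix.
Proof.
move=> rE; elim: ix k p => [|j ix IH] k p /=; first by rewrite big_nil mulr1.
rewrite rE -scalerAl -scalerAr scalerA linearZ IH big_cons.
by rewrite mulrA [k * _]mulrC.
Qed.

Lemma fold_op_map (F K : nzRingType) (f : {rmorphism F -> K})
    (s : I -> {poly F}) (p : {poly F}) ix :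
  fold_op (fun j => map_poly f (s j)) (map_poly f p) ix =
  map_poly f (fold_op s p ix).
Proof. by elim: ix p => //= j ix IH p; rewrite -rmorphM derivn_map IH. Qed.

(** At a point where no factor vanishes, the order of vanishing drops by exactly
    one at each differentiation. *)
Lemma fold_op_order r a ix e p h : (forall j, ~~ root (r j) a) ->
  (\sum_(j <- ix) nn j <= e)%N -> p = ('X - a%:P) ^+ e * h -> ~~ root h a ->
  exists2 g, fold_op r p ix = ('X - a%:P) ^+ (e - \sum_(j <- ix) nn j) * g
    & ~~ root g a.
Proof.
move=> ra.
have derivn_order k : forall e p h, (k <= e)%N -> p = ('X - a%:P) ^+ e * h ->
    ~~ root h a -> exists2 g, p^`(k) = ('X - a%:P) ^+ (e - k) * g & ~~ root g a.
  elim: k => [|k IH] {}e {}p {}h ke pE ha.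
    by exists h; rewrite ?subn0.
  case: e ke pE => // e ke pE; rewrite derivSn subSS.
  apply: (IH e _ (e.+1%:R *: h + ('X - a%:P) * h^`())) => //.
    rewrite pE derivM deriv_exp derivXsubC mul1r /= exprSr -mul_polyC.
    by rewrite -mulr_natr polyC_natr; ring.
  by rewrite rootE !hornerE subrr mul0r addr0 mulf_neq0 ?pnatr_eq0.
elim: ix e p h => [|j ix IH] e p h /=.
  by rewrite big_nil subn0 => _ -> ha; exists h.
rewrite big_cons => le pE ha.
have [g gE ga] : exists2 g, (r j * p)^`(nn j) = ('X - a%:P) ^+ (e - nn j) * g
    & ~~ root g a.
  apply: (derivn_order _ _ _ (r j * h)).
  - exact: leq_trans (leq_addr _ _) le.
  - by rewrite pE mulrCA.
  - by rewrite rootM negb_or ra.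
have [|q qE qa] := IH _ _ _ _ gE ga; first by lia.
by exists q => //; rewrite qE subnDA.
Qed.

(** Compare the orders at [a] of the image of a high power of ['X - a]: an
    operator of order [M] lowers it by at most [M], the factorized one by the
    number of differentiations exactly. *)
Lemma order_fold_op_leq M (rho : nat -> {poly C}) r a ix :
  (forall j, ~~ root (r j) a) ->
  (forall p, diff_op M rho p = fold_op r p ix) ->
  (\sum_(j <- ix) nn j <= M)%N.
Proof.
move=> ra LE; set S := (\sum_(j <- ix) nn j)%N.
have [|||g gE ga] :=
  @fold_op_order r a ix (M + S) (('X - a%:P) ^+ (M + S)) 1 ra.
- exact: leq_addl.
- by rewrite mulr1.
- by rewrite root1.
have := dvdp_diff_op_XsubC_exp M rho a S.
rewrite LE gE addnK leqNgt => dv; apply/negP => MS; move: dv.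
rewrite -(subnKC (ltnW MS)) exprD dvdp_mul2l ?expf_neq0 ?polyXsubC_eq0 //.
move=> dv; move/negP: ga; apply; rewrite -dvdp_XsubCl; apply: dvdp_trans dv.
by rewrite -[X in X %| _]expr1 dvdp_exp2l // subn_gt0.
Qed.

End Iterated.

End FactorizedOperators.

(** * The sequence of orthogonal polynomials *)

Section OrthogonalSequence.
Context {R : realType}.
Local Notation C := R[i].
Local Notation toC := (map_poly (real_complex R)).
Variable mu : {finite_measure set (measurableTypeR R) -> \bar R}.

Lemma node_poly_real N (nu : N.-tuple R) :
  node_poly nu = toC (\prod_(t <- nu) ('X - t%:P)).
Proof.
rewrite /node_poly rmorph_prod; apply: eq_bigr => t _.
by rewrite rmorphB /= map_polyX map_polyC.
Qed.

Lemma map_conjc_toC (f : {poly R}) : map_poly conjc (toC f) = toC f.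
Proof. by apply/polyP => i; rewrite !coef_map /= oppr0. Qed.

Lemma map_conjcK : involutive (map_poly (@conjc R)).
Proof. by move=> p; apply/polyP => i; rewrite !coef_map /= conjcK. Qed.

Lemma map_conjc_id (p : {poly C}) :
  map_poly conjc p = p -> p = toC (map_poly (@complex.Re R) p).
Proof.
move=> pJ; apply/polyP => i; rewrite coef_map coef_map_id0 //=.
move/(congr1 (fun q : {poly C} => q`_i)): pJ; rewrite coef_map /=.
case: (p`_i) => a b [/eqP]; rewrite eq_sym -addr_eq0 -mulr2n mulrn_eq0 /=.
by move=> /eqP ->.
Qed.

(** Up to the factor [k] the operator has real coefficients, and so have the
    nodes and the measure. Together with uniqueness, this makes the orthogonal
    polynomials real. *)
Lemma monic_orthogonal_vanishing_conj (I : eqType) (nn : I -> nat)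
    (s : I -> {poly R}) ix k M rho n N (nu : N.-tuple R) (Q : {poly C}) :
  has_moments mu -> k != 0 ->
  (forall p, diff_op M rho p = k *: fold_op nn (fun j => toC (s j)) p ix) ->
  monic_orthogonal_vanishing M rho mu n nu Q ->
  monic_orthogonal_vanishing M rho mu n nu (map_poly conjc Q).
Proof.
move=> hm k0 LE [Qm Qs [Qn Qo] Qv]; split.
- by rewrite map_monic.
- by rewrite size_map_poly.
- split; first by rewrite size_map_poly.
  move=> P Pn.
  have LJ : diff_op M rho (map_poly conjc Q) =
      (k / k^*) *: map_poly conjc (diff_op M rho Q).
    have sJ : (fun j => toC (s j)) = (fun j => map_poly conjc (toC (s j))).
      by apply/funext => j; rewrite map_conjc_toC.
    rewrite LE {1}sJ fold_op_map LE map_polyZ scalerA divfK //.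
    by rewrite conjc_eq0.
  have -> : (fun x : R =>
       (diff_op M rho (map_poly conjc Q)).[x%:C] * P.[x%:C]) =
     (fun x => ((k / k^*) *:
        map_poly conjc (diff_op M rho Q * map_poly conjc P)).[x%:C]).
    apply/funext => x; rewrite LJ rmorphM /= map_conjcK.
    by rewrite !hornerZ hornerM mulrA.
  rewrite CintegralZ // Cintegral_conj //.
  under [X in Cintegral _ X]eq_fun do rewrite hornerM.
  by rewrite Qo ?size_map_poly // conjc0 mulr0.
- move: Qv; rewrite node_poly_real => /dvdpP[h ->].
  by rewrite rmorphM /= map_conjc_toC dvdp_mulIr.
Qed.

Lemma hull_radius_zeros (p : {poly C}) (A : set C) z :
  cplx_convex_hull (zero_set p) `<=` A -> root p z ->
  ((cmod z)%:E <= hull_radius A)%E.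
Proof.
move=> pA rz; rewrite /hull_radius le_max; apply/orP; right.
apply: ereal_sup_ubound; exists z => //; apply: pA.
exists 1%N, (fun=> 1), (fun=> z); split => //; first by rewrite big_ord1.
by rewrite big_ord1 mul1r.
Qed.

Lemma cmod_real (a : R) : cmod a%:C = `|a|.
Proof. by rewrite /cmod /= expr0n addr0 sqrtr_sqr. Qed.

End OrthogonalSequence.

Theorem theorem18 (R : realType)
    (M : nat) (rho : nat -> {poly R[i]})
    (J : nat) (m nn : 'I_J -> nat) (r : 'I_J -> {poly R[i]})
    (mu : {finite_measure set (measurableTypeR R) -> \bar R})
    (j0 : 'I_J) (n' : nat)
    (nu : nat -> (n'.+1).-tuple R)
    (Q : nat -> {poly R[i]}) :
  exactly_solvable M rho ->
  is_factorization M rho m nn r ->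
  (forall (j : 'I_J) (z : R[i]), root (r j) z -> z \is Num.real) ->
  ~ (forall j : 'I_J, 0 <= partial_diff m nn j) ->
  in_Xi M rho mu ->
  msupport mu `<=` [set x : R | -1 <= x <= 1] ->
  partial_diff m nn j0 < 0 ->
  (forall j : 'I_J, partial_diff m nn j < 0 -> (j <= j0)%N) ->
  n'%:Z = \sum_(i < J | (i <= j0)%N) ((nn i)%:Z - (m i)%:Z) - 1 ->
  (forall n : nat, (n' < n)%N ->
     interpolating_system (fun k : 'I_n'.+1 => 'X^k : {poly R}) (nu n)) ->
  (forall n : nat, (n' < n)%N ->
     unique (monic_orthogonal_vanishing M rho mu n (nu n)) (Q n)) ->
  let CMn n := cplx_convex_hull
    (zero_set (node_poly (nu n) * \prod_(j < J) r j)) in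
  let CM := \bigcup_(n in [set n | (n' < n)%N]) CMn n in
  let d := hull_radius CM in
  forall (n : nat) (z : R[i]), (n' < n)%N -> root (Q n) z ->
    ((cmod z)%:E <= (3 ^+ M)%:E * d)%E.
Proof.
move=> [srho _ _] [_ sr LE] rreal _ [hm infs _] supp _ _ _ _ uQ.
move=> CMn CM d n z n'n rz.
pose toC (p : {poly R}) : {poly R[i]} := map_poly (real_complex R) p.
have /choice[zs zsP] : forall j, exists l : seq R, size l = m j /\
    r j = lead_coef (r j) *: toC (\prod_(a <- l) ('X - a%:P)).
  move=> j; have [l sl rE] := real_rooted_factorization (sr j) (rreal j).
  by exists l.
pose rp j := \prod_(a <- zs j) ('X - a%:P).
pose ix := enum 'I_J.
pose k := \prod_(j <- ix) lead_coef (r j).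
have k0 : k != 0.
  rewrite prodf_seq_neq0; apply/allP => j _ /=.
  by rewrite lead_coef_eq0 -size_poly_eq0 sr.
have Lr p :
    diff_op M rho p = k *: fold_op nn (fun j => toC (rp j)) p ix.
  rewrite LE -[X in iterated_op _ _ X]scale1r -[k]mul1r.
  by apply: fold_opZ => j; case: (zsP j).
(* If the balance of zeros failed, the operator would kill the node polynomial,
   of degree n'+1; adding it to Q (n'+2) would contradict uniqueness. *)
have prefix ix1 ix2 : ix = ix1 ++ ix2 ->
    (\sum_(j <- ix1) nn j <= n'.+1 + \sum_(j <- ix1) size (zs j))%N.
  move=> ixE; rewrite leqNgt; apply/negP => lt.
  have n2 : (n' < n'.+2)%N by exact: leqnSn.
  have [[Qm Qs [Qn Qo] Qv] uniq_] := uQ _ n2.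
  set w := node_poly (nu n'.+2).
  have wm : w \is monic by apply: monic_prod_XsubC.
  have ws : size w = n'.+2 by rewrite /w /node_poly size_prod_XsubC size_tuple.
  have w0 : w != 0 by rewrite monic_neq0.
  have sw : (size w < size (Q n'.+2))%N by rewrite ws Qs.
  have Lw : diff_op M rho w = 0.
    rewrite Lr ixE fold_op_kills ?scaler0 // ws.
    rewrite (eq_bigr (fun j => size (zs j))) ?addSn //.
    by move=> j _; rewrite size_map_poly size_prod_XsubC.
  have : Q n'.+2 = Q n'.+2 + w.
    apply: uniq_; split.
    - by rewrite monicE lead_coefDl // -monicE.
    - by rewrite size_polyDl.
    - split; first by rewrite size_polyDl.
      move=> P /Qo <-; congr Cintegral; apply/funext => x.
      by rewrite -[Q _]scale1r diff_op_linear Lw addr0 !scale1r.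
    - by rewrite dvdp_add.
  by move/eqP; rewrite -subr_eq0 opprD addrA subrr add0r oppr_eq0 (negPf w0).
have [QP uniq_] := uQ n n'n.
have [f fE] : exists f, Q n = toC f.
  exists (map_poly (@complex.Re R) (Q n)); apply: map_conjc_id.
  by apply/esym/uniq_; apply: monic_orthogonal_vanishing_conj Lr QP.
have [Qm Qs [Qn Qo] Qv] := QP.
have d1 : (1 <= d)%E by rewrite /d /hull_radius le_max lexx.
have zd y : root (node_poly (nu n) * \prod_(j < J) r j) y ->
    ((cmod y)%:E <= d)%E.
  by apply: hull_radius_zeros => x hx; exists n.
case dE : d d1 zd => [b| |] // b1 zd; last first.
  by rewrite gt0_muley ?leey // lte_fin exprn_gt0.
rewrite -EFinM lee_fin; rewrite lee_fin in b1.
pose ln := tval (nu n).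
have lnb a : a \in ln -> `|a| <= b.
  move=> al; rewrite -cmod_real -lee_fin; apply: zd; rewrite rootM.
  have ra : root (\prod_(t <- ln) ('X - t%:P)) a by rewrite root_prod_XsubC.
  apply/orP; left; rewrite node_poly_real; apply/rootP.
  by rewrite horner_map (rootP ra) rmorph0.
have zsb j a : a \in zs j -> `|a| <= b.
  move=> aj; rewrite -cmod_real -lee_fin; apply: zd; rewrite rootM.
  apply/orP; right; rewrite (bigD1 j) //= rootM; apply/orP; left.
  have ra : root (rp j) a by rewrite root_prod_XsubC.
  have [_ ->] := zsP j; apply/rootP.
  by rewrite hornerZ /toC horner_map (rootP ra) rmorph0 mulr0.
have f0 : f != 0.
  apply: contraTneq Qm => f0'; rewrite fE f0' /toC rmorph0.
  by rewrite monicE lead_coef0 eq_sym oner_eq0.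
have lnf : \prod_(a <- ln) ('X - a%:P) %| f.
  by move: Qv; rewrite fE node_poly_real dvdp_map.
have b0 : 0 <= b by apply: le_trans b1.
have sln : size ln = n'.+1 by rewrite size_tuple.
have [|g0 fb] :=
  @roots_in_disk_iterated R 'I_J zs nn b ix ln f b0 f0 lnb zsb lnf.
  by move=> ix1 ix2 /prefix; rewrite sln.
set g := foldl _ _ _ in g0 fb.
have LQ : diff_op M rho (Q n) = k *: toC g.
  by rewrite Lr fE fold_op_map.
have gb : roots_in_disk b g.
  move=> y gy; apply: le_trans (_ : 1 <= _); last by rewrite -[1]/(1%:C) lecR.
  apply: (orthogonal_roots_in_disk hm infs supp _ _ Qo).
  - by rewrite LQ scaler_eq0 negb_or k0 map_poly_eq0.
  - by rewrite -Qs size_diff_op.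
  - by rewrite LQ rootZ.
(* The factors have real zeros only, so that none of them vanishes at 'i. *)
have SM : (\sum_(j <- ix) nn j <= M)%N.
  apply: (@order_fold_op_leq R _ nn M rho r 'i ix) => // j.
  apply/negP => /rreal; rewrite -[X in X \is _]/(0 +i* 1) complex_real.
  by rewrite oner_eq0.
have /(_ z) := fb b (lexx _) gb.
rewrite -[map_poly _ f]/(toC f) -fE => /(_ rz).
rewrite [`|z|]/(_%:C) lecR => /le_trans; apply.
by rewrite ler_wpM2r // ler_weXn2l // ler1n.
Qed.
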